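(* If $G$ is isomorphic to one of the groups $D_{2n}$ ($n\ge 3$), $Q_{4m}$ ($m\ge 2$), $U_{(n,m)}$ ($m\ge 2$, $n\ge 2$), $V_{8n}$ ($n\ge 2$) or $SD_{8n}$ ($n\ge 2$), then the commuting conjugacy class graph $\mathcal{CCC}(G)$ is super integral.
   Context: The groups are $D_{2n} = \langle x, y : x^n = y^2 = 1,\ yxy = x^{-1}\rangle$, $Q_{4m} = \langle x, y : x^{2m} = 1,\ x^m = y^2,\ y^{-1}xy = x^{-1}\rangle$, $U_{(n,m)} = \langle x, y : x^{2n} = y^m = 1,\ x^{-1}yx = y^{-1}\rangle$, $V_{8n} = \langle x, y : x^{2n} = y^4 = 1,\ yx = x^{-1}y^{-1},\ y^{-1}x = x^{-1}y\rangle$, $SD_{8n} = \langle x, y : x^{4n} = y^2 = 1,\ yxy = x^{2n-1}\rangle$. For a finite non-abelian group $G$, the commuting conjugacy class graph $\mathcal{CCC}(G)$ is the simple undirected graph whose vertices are the conjugacy classes of the non-central elements of $G$; two distinct vertices $x^G$ and $y^G$ are adjacent iff there exist $x'\in x^G$ and $y'\in y^G$ with $x'y'=y'x'$. For a finite graph $\mathcal{G}$ with adjacency matrix $A(\mathcal{G})$ and (diagonal) degree matrix $D(\mathcal{G})$, put $L(\mathcal{G})=D(\mathcal{G})-A(\mathcal{G})$ and $Q(\mathcal{G})=D(\mathcal{G})+A(\mathcal{G})$. The graph $\mathcal{G}$ is integral (respectively L-integral, Q-integral) if all eigenvalues of $A(\mathcal{G})$ (respectively $L(\mathcal{G})$,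 $Q(\mathcal{G})$) are integers. It is super integral if it is integral, L-integral and Q-integral. *)

(* Defs.v *)
From mathcomp Require Import all_boot all_order all_algebra all_fingroup.
From mathcomp Require Import all_solvable all_field.

Set Implicit Arguments.
Unset Strict Implicit.
Unset Printing Implicit Defensive.

Import GRing.Theory.

Record simple_graph := SimpleGraph {
  vertex :> finType;
  adj : rel vertex;
  adj_sym : symmetric adj;
  adj_irrefl : irreflexive adj }.

Section Spectrum.

Local Open Scope ring_scope.

Variable Gr : simple_graph.

Definition degree (u : Gr) : nat := #|[set v : Gr | adj u v]|.

(* The vertices are numbered by [enum_val : 'I_#|Gr| -> Gr]. *)
Definition adjacency_mx : 'M[algC]_#|Gr| :=
  \matrix_(i, j) (adj (enum_val i : Gr) (enum_val j))%:R.

Definition degree_mx : 'M[algC]_#|Gr| :=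
  diag_mx (\row_i (degree (enum_val i))%:R).

Definition laplacian_mx : 'M[algC]_#|Gr| := degree_mx - adjacency_mx.

Definition signless_laplacian_mx : 'M[algC]_#|Gr| := degree_mx + adjacency_mx.

(* The entries of the three matrices are integers, so all their complex
   eigenvalues lie in [algC]. *)
Definition integral_spectrum n (A : 'M[algC]_n) : Prop :=
  forall a : algC, eigenvalue A a -> a \is a Num.int.

Definition integral_graph : Prop := integral_spectrum adjacency_mx.
Definition L_integral_graph : Prop := integral_spectrum laplacian_mx.
Definition Q_integral_graph : Prop := integral_spectrum signless_laplacian_mx.

Definition super_integral : Prop :=
  [/\ integral_graph, L_integral_graph & Q_integral_graph].

End Spectrum.

Local Open Scope group_scope.

Section CommutingConjugacyClassGraph.

Variables (gT : finGroupType) (G : {group gT}).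

Definition noncentral_classes : {set {set gT}} :=
  [set x ^: G | x in G :\: 'Z(G)].

Definition ccc_vertex : finType := {C : {set gT} | C \in noncentral_classes}.

Definition ccc_adj (C D : ccc_vertex) : bool :=
  (C != D) && [exists x in val C, exists y in val D, x * y == y * x].

Lemma ccc_adj_sym : symmetric ccc_adj.
Proof.
suff sub C D : ccc_adj C D -> ccc_adj D C by move=> C D; apply/idP/idP; apply: sub.
case/andP=> neqCD /exists_inP[x Cx /exists_inP[y Dy /eqP xy]].
rewrite /ccc_adj eq_sym neqCD /=; apply/exists_inP; exists y => //.
by apply/exists_inP; exists x => //; rewrite xy.
Qed.

Lemma ccc_adj_irrefl : irreflexive ccc_adj.
Proof. by move=> C; rewrite /ccc_adj eqxx. Qed.

(* For abelian [G] this is the graph without vertices. *)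
Definition CCC : simple_graph := SimpleGraph ccc_adj_sym ccc_adj_irrefl.

End CommutingConjugacyClassGraph.

(* All the presentations below define finite groups, and for those
   [G \isog Grp (...)] says that [G] is isomorphic to the presented group. *)
Section Presentations.

Variables (gT : finGroupType) (G : {group gT}).

Definition is_D (n : nat) : Prop :=
  G \isog Grp (x : y : x ^+ n = y ^+ 2 = 1, y * x * y = x^-1).

Definition is_Q (m : nat) : Prop :=
  G \isog Grp (x : y : x ^+ (2 * m) = 1, x ^+ m = y ^+ 2,
                       y^-1 * x * y = x^-1).

Definition is_U (n m : nat) : Prop :=
  G \isog Grp (x : y : x ^+ (2 * n) = y ^+ m = 1, x^-1 * y * x = y^-1).

Definition is_V (n : nat) : Prop :=
  G \isog Grp (x : y : x ^+ (2 * n) = y ^+ 4 = 1, y * x = x^-1 * y^-1,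
                       y^-1 * x = x^-1 * y).

Definition is_SD (n : nat) : Prop :=
  G \isog Grp (x : y : x ^+ (4 * n) = y ^+ 2 = 1,
                       y * x * y = x ^+ (2 * n - 1)).

End Presentations.

(* Main.v *)
(** In each of the five families [G] has an abelian subgroup [A] of index at
    most 2: [<x>] for [D], [Q] and [SD], [<x^2, y>] for [U] and [<x, y^2>] for
    [V].  This makes commutation transitive on noncentral elements: the
    centralizer of a noncentral [g] is [A] if [g] lies in [A], and ['Z(G) <g>]
    otherwise.  Hence the commuting conjugacy class graph is a disjoint union of
    cliques, and on a clique of size [k] the adjacency, Laplacian and signless
    Laplacian matrices have the eigenvalues [k - 1, -1], [0, k] and
    [2k - 2, k - 2]. *)

Require Import Defs.
From mathcomp Require Import all_boot all_order all_algebra all_fingroup.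
From mathcomp Require Import all_solvable all_field.

Set Implicit Arguments.
Unset Strict Implicit.
Unset Printing Implicit Defensive.

Import GRing.Theory Num.Theory.

(** * Spectra of disjoint unions of cliques *)

Section DisjointCliques.

Local Open Scope ring_scope.

Section BlockMatrix.

Variables (n : nat) (r : rel 'I_n) (d : 'I_n -> algC) (b : algC).
Hypotheses (r_refl : reflexive r) (r_sym : symmetric r).
Hypothesis r_trans : transitive r.
Hypothesis d_class : forall i j, r i j -> d i = d j.
Hypotheses (d_int : forall i, d i \is a Num.int) (b_int : b \is a Num.int).

(** For a row eigenvector [v] let [s j] be the sum of [v] over the class of [j]; coordinate [j] of
    the eigenvalue equation is [d j * v j + b * s j = a * v j]. Take [v j] nonzero: if [s j] is zero
    then [a = d j], otherwise [a = d j + b * k] with [k] the size of the class. *)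
Lemma block_mx_integral (M : 'M[algC]_n) :
  (forall i j, M i j = d i * (i == j)%:R + b * (r i j)%:R) ->
  integral_spectrum M.
Proof.
move=> defM a /eigenvalueP[v vM v_neq0].
pose s j := \sum_(i | r i j) v ord0 i.
have eig j : d j * v ord0 j + b * s j = a * v ord0 j.
  have /rowP/(_ j) := vM; rewrite !mxE => <-.
  under eq_bigr => i _ do rewrite defM mulrDr.
  rewrite big_split /= (bigD1 j) //= eqxx mulr1 big1 ?addr0 => [|i /negbTE->].
    rewrite mulrC; congr (_ + _); rewrite /s big_mkcond mulr_sumr.
    by apply: eq_bigr => i _; case: (r i j); rewrite ?mulr0 ?mulr1 // mulrC.
  by rewrite !mulr0.
have r_class i j k : r i j -> r k i = r k j.
  move=> rij; apply/idP/idP => rk; apply: r_trans rk _ => //.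
  by rewrite r_sym.
have [j vj] : exists j, v ord0 j != 0.
  apply/existsP; apply: contraNT v_neq0 => /existsPn v0.
  by apply/eqP/rowP => j; rewrite mxE; apply/eqP/negbNE/v0.
have [sj0 | sj_neq0] := eqVneq (s j) 0.
  by have := eig j; rewrite sj0 mulr0 addr0 => /(mulIf vj) <-.
(* Summing [eig] over the class of [j] gives an equation for [s j] alone. *)
pose k := \sum_(i | r i j) (1 : algC).
have sumE : (d j + b * k) * s j = a * s j.
  transitivity (\sum_(i | r i j) (d i * v ord0 i + b * s i)).
    rewrite big_split /= mulrDl; congr (_ + _).
      by rewrite mulr_sumr; apply: eq_bigr => i rij; rewrite (d_class rij).
    rewrite -mulrA mulr_suml mulr_sumr; apply: eq_bigr => i rij.
    by rewrite mul1r; congr (b * _); apply: eq_bigl => l; rewrite (r_class i j).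
  by rewrite mulr_sumr; apply: eq_bigr => i _; apply: eig.
rewrite -(mulIf sj_neq0 sumE) rpredD ?rpredM ?rpred_sum // => i _.
exact: rpred1.
Qed.

End BlockMatrix.

(** With [J] the 0-1 matrix of [r] and [D] the degree matrix, which is constant on classes, the
    three matrices are [J - I], [(D + I) - J] and [(D - I) + J], all of the block form above. *)
Lemma clique_graph_super_integral (Gr : simple_graph) (r : rel Gr) :
    reflexive r -> symmetric r -> transitive r ->
    (forall u v, adj u v = (u != v) && r u v) ->
  super_integral Gr.
Proof.
move=> r_refl r_sym r_trans adjE.
pose r' : rel 'I_#|Gr| := fun i j => r (enum_val i) (enum_val j).
have r'_refl : reflexive r' by move=> i; apply: r_refl.
have r'_sym : symmetric r' by move=> i j; apply: r_sym.
have r'_trans : transitive r' by move=> i j k; apply: r_trans.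
pose D (i : 'I_#|Gr|) := (degree (enum_val i : Gr))%:R : algC.
have D_class i j : r' i j -> D i = D j.
  move=> rij; congr (_%:R).
  have degE u : degree (u : Gr) = #|[set v | r u v]|.-1.
    rewrite (cardsD1 u) inE r_refl; apply: eq_card => v.
    by rewrite !inE adjE eq_sym.
  rewrite !degE; congr (_.-1); apply: eq_card => v; rewrite !inE.
  by apply/idP/idP; apply: r_trans; rewrite // r_sym.
have D_int i : D i \is a Num.int by rewrite natr_int.
have adjacencyE i j : adjacency_mx Gr i j = (r' i j)%:R - (i == j)%:R.
  rewrite mxE adjE (inj_eq enum_val_inj) -/(r' i j).
  by case: eqP => [->|_]; rewrite ?r'_refl ?subrr ?subr0.
have degreeE i j : degree_mx Gr i j = D i * (i == j)%:R.
  by rewrite !mxE mulr_natr.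
split.
- apply: (@block_mx_integral _ r' (fun=> -1) 1) => // [i|i j].
    by rewrite rpredN rpred1.
  by rewrite adjacencyE mul1r mulN1r addrC.
- apply: (@block_mx_integral _ r' (fun i => D i + 1) (-1)) => //.
  + by move=> i j /D_class->.
  + by move=> i; rewrite rpredD ?rpred1.
  + by rewrite rpredN rpred1.
  move=> i j; rewrite mxE [in X in _ + X]mxE degreeE adjacencyE.
  by rewrite mulrDl mul1r mulN1r opprB addrA.
apply: (@block_mx_integral _ r' (fun i => D i - 1) 1) => //.
- by move=> i j /D_class->.
- by move=> i; rewrite rpredB ?rpred1.
by move=> i j; rewrite mxE degreeE adjacencyE mulrBl !mul1r addrA addrAC.
Qed.

End DisjointCliques.

(** * Transitivity of commutation in groups with a large abelian subgroup *)

Local Open Scope group_scope.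

Lemma CCC_super_integral (gT : finGroupType) (G : {group gT}) :
    (forall x y z, x \in G -> y \in G :\: 'Z(G) -> z \in G ->
      commute x y -> commute y z -> commute x z) ->
  super_integral (CCC G).
Proof.
move=> comm_trans.
have vertexP (C : CCC G) x : x \in val C -> val C = x ^: G /\ x \in G :\: 'Z(G).
  have /imsetP[g GZg ->] := valP C => /imsetP[h Gh ->{x}].
  split; first by rewrite classGidl.
  case/setDP: GZg => Gg nZg; apply/setDP; rewrite groupJ // memJ_norm //.
  exact: (subsetP (normal_norm (center_normal G))).
pose r (C D : CCC G) :=
  [exists x in val C, exists y in val D, x * y == y * x].
apply: (@clique_graph_super_integral (CCC G) r) => //.
- move=> C; have /imsetP[x _ defC] := valP C.
  apply/exists_inP; exists x; first by rewrite defC class_refl.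
  by apply/exists_inP; exists x; rewrite ?defC ?class_refl.
- suff sub C D : r C D -> r D C by move=> C D; apply/idP/idP; apply: sub.
  case/exists_inP=> x Cx /exists_inP[y Dy /eqP xy].
  by apply/exists_inP; exists y => //; apply/exists_inP; exists x; rewrite ?xy.
move=> D C E /exists_inP[x Cx /exists_inP[y Dy /eqP xy]].
case/exists_inP=> y' Dy' /exists_inP[z Ez /eqP yz].
have [_ /setDP[Gx _]] := vertexP _ _ Cx.
have [defD GZy] := vertexP _ _ Dy.
have [defE /setDP[Gz _]] := vertexP _ _ Ez.
have [defD' _] := vertexP _ _ Dy'.
(* The two adjacencies may use different representatives [y] and [y'] of [D]; conjugating the pair
   [y'], [z] by [g] turns [y'] into [y], so that [z ^ g] commutes with [y]. *)
have /imsetP[g Gg defy] : y \in y' ^: G by rewrite -defD'.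
apply/exists_inP; exists x => //; apply/exists_inP; exists (z ^ g).
  by rewrite defE memJ_class.
apply/eqP/(comm_trans x y) => //; first by rewrite groupJ.
by rewrite /commute defy -!conjMg yz.
Qed.

(** The condition on [u * v^-1] expresses index at most 2 without cosets. The key point is
    [centralP]: an element of [A] commuting with some [u] of [G] outside [A] commutes with all of
    [G], because any other element outside [A] lies in [A :* u]. *)
Lemma commute_trans_abelian_index2 (gT : finGroupType) (G A : {group gT}) :
    abelian A -> {in G :\: A &, forall u v, u * v^-1 \in A} ->
  forall x y z, x \in G -> y \in G :\: 'Z(G) -> z \in G ->
    commute x y -> commute y z -> commute x z.
Proof.
move=> abA indexA x y z Gx /setDP[Gy nZy] Gz xy yz.
have commA a b : a \in A -> b \in A -> commute a b.
  by move=> Aa Ab; apply: (centsP abA).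
have centralP a u : a \in A -> u \in G :\: A -> commute a u ->
    forall g, g \in G -> commute a g.
  move=> Aa GAu au g Gg; have [Ag | nAg] := boolP (g \in A); first exact: commA.
  rewrite -(mulgKV u g); apply: commuteM => //.
  by apply/commA/indexA; rewrite // inE nAg.
have [Ay | nAy] := boolP (y \in A).
  have inA u : u \in G -> commute y u -> u \in A.
    move=> Gu yu; apply: contraNT nZy => nAu; apply/centerP; split=> // g.
    by apply: (centralP _ u); rewrite // inE nAu.
  by apply: commA; apply: inA => //; apply: commute_sym.
have GAy : y \in G :\: A by rewrite inE nAy.
(* For [y] outside [A], whatever commutes with [y] is central or central times [y]: if [u] is not in
   [A], then [u * y^-1] lies in [A] and commutes with [y]. *)
have split_y u : u \in G -> commute y u ->
    exists a b,
      [/\ u = a * b, forall g, g \in G -> commute a g & b = 1 \/ b = y].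
  move=> Gu yu; have [Au | nAu] := boolP (u \in A).
    exists u, 1; split; rewrite ?mulg1 //; last by left.
    by apply: (centralP _ y); rewrite //; apply: commute_sym.
  exists (u * y^-1), y; split; rewrite ?mulgKV //; last by right.
  apply: (centralP _ y) => //; first by apply: indexA; rewrite // inE nAu.
  apply/commute_sym/commuteM => //; exact/commuteV.
have [a [b [defx Za b1y]]] := split_y x Gx (commute_sym xy).
have [c [e [defz Zc e1y]]] := split_y z Gz yz.
rewrite defx; apply: commute_sym; apply: commuteM.
  exact/commute_sym/Za.
apply: commute_sym; rewrite defz; apply: commuteM.
  apply/commute_sym/Zc.
  by case: b1y => ->; rewrite ?group1.
case: b1y => ->; first exact/commute_sym/commute1.
by case: e1y => ->; first exact: commute1.
Qed.

Lemma CCC_super_integral_abelian_index2 (gT : finGroupType)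
    (G A : {group gT}) (g : gT) :
    abelian A -> g \in 'N(A) -> g ^+ 2 \in A -> G :=: A <*> <[g]> ->
  super_integral (CCC G).
Proof.
move=> abA nAg Ag2 defG.
apply/CCC_super_integral/(commute_trans_abelian_index2 abA).
have coset_g u : u \in G :\: A -> u \in A :* g.
  rewrite defG norm_joinEr ?cycle_subG // => /setDP[/mulsgP[a h Aa]].
  (* Even powers of [g] lie in [A], so an element outside [A] involves an odd power, which is [g] up
     to a factor in [A]. *)
  case/cycleP=> k -> ->; rewrite -(odd_double_half k) expgD -muln2 mulnC expgM.
  have Agk : (g ^+ 2) ^+ k./2 \in A by apply: groupX.
  case: (odd k) => /=; last by rewrite expg0 mul1g groupM.
  rewrite expg1 -expgM -[g * _]expgS expgSr mulgA expgM => _.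
  by rewrite mem_rcoset mulgK groupM.
move=> u v /coset_g/rcosetP[a Aa ->] /coset_g/rcosetP[b Ab ->].
by rewrite invMg mulgA mulgK groupM ?groupV.
Qed.

(** Form used for [U] and [V], where the abelian subgroup has two commuting generators. *)
Lemma CCC_super_integral_2gen (gT : finGroupType) (G : {group gT})
    (a b g : gT) :
    commute a b -> a ^ g \in <<[set a; b]>> -> b ^ g \in <<[set a; b]>> ->
    g ^+ 2 \in <<[set a; b]>> -> G :=: <<[set a; b]>> <*> <[g]> ->
  super_integral (CCC G).
Proof.
move=> ab ag bg g2 defG.
apply: (@CCC_super_integral_abelian_index2 _ G <<[set a; b]>> g) => //.
  rewrite abelian_gen; apply/centsP=> u Su v Sv.
  by case/set2P: Su => ->; case/set2P: Sv => ->.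
rewrite inE -genJ gen_subG; apply/subsetP=> _ /imsetP[u Su ->].
by case/set2P: Su => ->.
Qed.

(** Form used for [D], [Q] and [SD], where the abelian subgroup is cyclic. *)
Lemma CCC_super_integral_cyclic_index2 (gT : finGroupType) (G : {group gT})
    (x y : gT) :
    x ^ y \in <[x]> -> y ^+ 2 \in <[x]> -> G :=: <[x]> <*> <[y]> ->
  super_integral (CCC G).
Proof.
move=> xy y2; apply: CCC_super_integral_abelian_index2 => //.
  exact: cycle_abelian.
by rewrite inE -cycleJ cycle_subG.
Qed.

Theorem corollary3p6 (gT : finGroupType) (G : {group gT})
  (hG : [\/ exists2 n : nat, (3 <= n)%N & is_D G n,
            exists2 m : nat, (2 <= m)%N & is_Q G m,
            exists n m : nat, [/\ (2 <= m)%N, (2 <= n)%N & is_U G n m]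
          | (exists2 n : nat, (2 <= n)%N & is_V G n) \/
            (exists2 n : nat, (2 <= n)%N & is_SD G n)]) :
  super_integral (CCC G).
Proof.
have y2_conj (x y : gT) : y ^+ 2 = 1 -> x ^ y = y * x * y.
  move=> y2; rewrite conjgE -mulgA; congr (_ * (x * y)).
  by apply/eqP; rewrite eq_invg_mul -expg2 y2.
case: hG => [[n _]|[m _]|[n [m [_ _]]]|[[n _]|[n _]]];
  move=> /isoGrp_hom/existsP[[x y] /=].
- case/eqP=> defG _ y2 xy; apply: CCC_super_integral_cyclic_index2 (esym defG).
    by rewrite y2_conj // xy groupV cycle_id.
  by rewrite y2 group1.
- case/eqP=> defG _ y2 xy; apply: CCC_super_integral_cyclic_index2 (esym defG).
    by rewrite conjgE mulgA xy groupV cycle_id.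
  by rewrite -y2 mem_cycle.
- case/eqP=> defG _ _ yx.
  (* In [U] it is [x] that acts: it inverts [y], so [x ^+ 2] centralizes [y]. *)
  have yJx : y ^ x = y^-1 by rewrite conjgE mulgA.
  have [Ax Ay]: x ^+ 2 \in <<[set x ^+ 2; y]>> /\ y \in <<[set x ^+ 2; y]>>.
    by rewrite !mem_gen ?set21 ?set22.
  apply: (@CCC_super_integral_2gen _ G (x ^+ 2) y x) => //.
  + by apply/esym/commgP/conjg_fixP; rewrite expg2 conjgM yJx conjVg yJx invgK.
  + by rewrite expg2 conjgE -mulgA mulKg -expg2.
  + by rewrite yJx groupV.
  have [Gx Gy] : x \in G /\ y \in G.
    by rewrite -defG -!cycle_subG joing_subl joing_subr.
  apply/eqP; rewrite eqEsubset -{1}defG !join_subG !cycle_subG !sub1set.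
  rewrite groupX // Gx Gy (subsetP (joing_subl _ _) y Ay).
  by rewrite (subsetP (joing_subr _ _) x (cycle_id x)).
- case/eqP=> defG _ y4 yx yVx.
  (* In [V] the two relations give [x ^ y = x^-1 * y ^+ 2] and [x ^ y^-1 = x^-1 * y ^- 2]. These
     agree since [y ^+ 4 = 1], so [y ^+ 2] centralizes [x]. *)
  have xJy : x ^ y = x^-1 * y ^+ 2 by rewrite conjgE mulgA yVx -mulgA.
  have y2V : (y ^+ 2)^-1 = y ^+ 2.
    by apply/eqP; rewrite eq_invg_mul -expgD y4.
  have xJyV : x ^ y^-1 = x^-1 * y ^+ 2.
    by rewrite conjgE invgK mulgA yx -mulgA -invMg -expg2 y2V.
  have [Ax Ay]: x \in <<[set x; y ^+ 2]>> /\ y ^+ 2 \in <<[set x; y ^+ 2]>>.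
    by rewrite !mem_gen ?set21 ?set22.
  apply: (@CCC_super_integral_2gen _ G x (y ^+ 2) y) => //.
  + by apply/commgP/conjg_fixP; rewrite {1}expg2 conjgM xJy -xJyV conjgKV.
  + by rewrite xJy groupM ?groupV.
  + by rewrite expg2 conjgE -mulgA mulKg -expg2.
  have [Gx Gy] : x \in G /\ y \in G.
    by rewrite -defG -!cycle_subG joing_subl joing_subr.
  apply/eqP; rewrite eqEsubset -{1}defG !join_subG !cycle_subG !sub1set.
  rewrite groupX // Gx Gy (subsetP (joing_subl _ _) x Ax).
  by rewrite (subsetP (joing_subr _ _) y (cycle_id y)).
case/eqP=> defG _ y2 xy; apply: CCC_super_integral_cyclic_index2 (esym defG).
  by rewrite y2_conj // xy mem_cycle.
by rewrite y2 group1.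
Qed.
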